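(* Let $C$ be a non-empty finite subset of $\mathbb{Z}$ and let $D$ be the set of all positive divisors of $\gcd(C)$. Then $${\rm I}(C)\setminus\{\{0\}\}=\bigcup_{d\in D}\left\{dS : S\in{\rm NI}\left(\tfrac{C}{d}\right)\right\}.$$
   Context: $\mathbb{N}$ denotes the non-negative integers. For $C\subseteq\mathbb{Z}$, a $C$-incentive is a submonoid $M$ of $(\mathbb{N},+)$ such that $s+t+c\in M$ for all $s,t\in M\setminus\{0\}$ and all $c\in C$. A $C$-incentive $M$ is numerical if $\gcd(M)=1$ (equivalently, $\mathbb{N}\setminus M$ is finite). ${\rm I}(C)$ is the set of all $C$-incentives and ${\rm NI}(C)$ the set of all numerical $C$-incentives. For $d\in D$, $\frac{C}{d}=\{c/d : c\in C\}$ and $dS=\{ds : s\in S\}$. If $C=\{0\}$ then $\gcd(C)=0$ and every positive integer is a divisor of $0$. *)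

(* Defs.v *)
From mathcomp Require Import all_boot all_order all_algebra.
From mathcomp Require Import mathcomp_extra boolp classical_sets functions cardinality.

Set Implicit Arguments.
Unset Strict Implicit.
Unset Printing Implicit Defensive.

Import Order.TTheory GRing.Theory Num.Theory.

Local Open Scope classical_set_scope.
Local Open Scope ring_scope.

Definition common_divisor (A : set int) (e : nat) : Prop :=
  forall a, A a -> (e%:Z %| a)%Z.

Definition is_gcd (A : set int) (g : nat) : Prop :=
  common_divisor A g /\ forall e, common_divisor A e -> (e %| g)%N.

(* The gcd is needed for arbitrary, possibly infinite, sets of integers, so it
   is chosen among the (unique) solutions of [is_gcd]; it exists for every [A]
   by [gcd_setP], so the default value 0 is never used. Both the empty set and
   [set 0] have gcd 0. *)
Definition gcd_set (A : set int) : nat := xget 0%N (is_gcd A).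

Definition submonoid (M : set nat) : Prop :=
  M 0%N /\ forall s t, M s -> M t -> M (s + t)%N.

(* The sum [s + t + c] is computed in [int]; it has to be nonnegative and to
   belong to [M], which is what membership in the image of [M] expresses. *)
Definition incentive (C : set int) (M : set nat) : Prop :=
  submonoid M /\
  forall s t c, (M `\ 0%N) s -> (M `\ 0%N) t -> C c ->
    (Posz @` M) (s%:Z + t%:Z + c).

Definition numerical (M : set nat) : Prop := gcd_set (Posz @` M) = 1%N.

Definition incentives (C : set int) : set (set nat) :=
  [set M | incentive C M].

Definition numerical_incentives (C : set int) : set (set nat) :=
  [set M | incentive C M /\ numerical M].

Definition positive_divisors (n : nat) : set nat :=
  [set d | (0 < d)%N /\ (d %| n)%N].

(* [divz] is Euclidean division; it is exact when [d] divides every element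
   of [C], the only case in which it is used. *)
Definition quotient_set (C : set int) (d : nat) : set int :=
  [set (c %/ d%:Z)%Z | c in C].

Definition dilate (d : nat) (S : set nat) : set nat :=
  [set (d * s)%N | s in S].

Lemma is_gcd_exists (A : set int) : exists g, is_gcd A g.
Proof.
have [A0|/existsNP[a /not_implyP[Aa /eqP a0]]] := pselect (forall a, A a -> a = 0).
  exists 0%N; split=> [a /A0->|e _]; first by rewrite dvdz0.
  exact: dvdn0.
pose P (e : 'I_(`|a|%N.+1)) := `[< common_divisor A e >].
exists (\big[lcmn/1%N]_(e | P e) nat_of_ord e); split=> [b Ab|e eA].
  rewrite dvdzE /=; apply/dvdn_biglcmP => e Pe; have eA := asboolW Pe.
  by have := eA _ Ab; rewrite dvdzE.
have ea : (e < `|a|%N.+1)%N.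
  rewrite ltnS; apply: dvdn_leq; first by rewrite absz_gt0.
  by have := eA _ Aa; rewrite dvdzE.
by apply: (@biglcmn_sup _ (Ordinal ea)) => //; apply/asboolP.
Qed.

Lemma gcd_setP (A : set int) : is_gcd A (gcd_set A).
Proof. by apply: xgetPex; exact: is_gcd_exists. Qed.

(* Main.v *)
Require Import Defs.
From mathcomp Require Import all_boot all_order all_algebra.
From mathcomp Require Import mathcomp_extra boolp classical_sets functions cardinality.

(** Dilation by [d > 0] identifies the [C / d]-incentives [S] with the
    [C]-incentives [d S], as soon as [d] divides every element of [C].
    Given a [C]-incentive [M] different from [{0}], take [d = gcd M]: then
    [M = d S] with [gcd S = 1], and [d] divides every [c] in [C] because [M]
    contains both [m] and [m + m + c] for any nonzero [m] in [M]. *)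

Local Open Scope classical_set_scope.

Local Open Scope ring_scope.

Import GRing.Theory.

Lemma mem_dilate (d : nat) (S : set nat) (s : nat) :
  (0 < d)%N -> dilate d S (d * s)%N <-> S s.
Proof.
move=> d0; split=> [[t St /eqP]|Ss]; last by exists s.
by rewrite eqn_pmul2l// => /eqP <-.
Qed.

(** Incentive sums live in [int] and may a priori be negative, so [mem_dilate] is needed for an
    arbitrary integer [z]. *)
Lemma mem_image_dilate (d : nat) (S : set nat) (z : int) : (0 < d)%N ->
  (Posz @` dilate d S) (d%:Z * z)%R <-> (Posz @` S) z.
Proof.
move=> d0; split=> [[_ [s Ss <-]]|[s Ss <-]]; last first.
  by exists (d * s)%N; [exists s|rewrite PoszM].
have dN0 : d%:Z != 0%R by rewrite eqz_nat -lt0n.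
by rewrite PoszM => /(mulfI dN0) <-; exists s.
Qed.

Lemma submonoid_dilate (d : nat) (S : set nat) :
  (0 < d)%N -> submonoid (dilate d S) <-> submonoid S.
Proof.
move=> d0; split=> -[S0 SD]; split.
- by apply/(mem_dilate d S _ d0); rewrite muln0.
- move=> s t /(mem_dilate d S _ d0) Ss /(mem_dilate d S _ d0) St.
  by apply/(mem_dilate d S _ d0); rewrite mulnDr; exact: SD.
- by exists 0%N; rewrite ?muln0.
- move=> _ _ [s Ss <-] [t St <-]; rewrite -mulnDr.
  by exists (s + t)%N => //; exact: SD.
Qed.

Lemma incentive_dilate (C : set int) (d : nat) (S : set nat) :
  (0 < d)%N -> common_divisor C d ->
  incentive C (dilate d S) <-> incentive (quotient_set C d) S.
Proof.
move=> d0 dC; have [mS Sm] := submonoid_dilate d S d0.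
(* The factor [d] comes out of the whole sum because [c %/ d] is exact, by [dC]. Both directions
   then reduce to [mem_image_dilate]. *)
have distr s t c : C c -> ((d * s)%N%:Z + (d * t)%N%:Z + c =
    d%:Z * (s%:Z + t%:Z + (c %/ d%:Z)%Z))%R.
  by move=> Cc; rewrite !mulrDr !PoszM [(_ * (c %/ _)%Z)%R]mulrC divzK// dC.
split=> -[subm inc]; split; [exact: mS| |exact: Sm|].
- move=> s t _ [Ss /= s0] [St /= t0] [c Cc <-].
  apply/(mem_image_dilate d S _ d0); rewrite -distr//.
  have mul0 u : u <> 0%N -> (d * u)%N <> 0%N.
    by move=> u0 /eqP; rewrite muln_eq0 gtn_eqF//= => /eqP.
  by apply: inc => //; split; rewrite ?mem_dilate//; exact: mul0.
- move=> _ _ c [[s Ss <-] /= s0] [[t St <-] /= t0] Cc.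
  rewrite distr//; apply/(mem_image_dilate d S _ d0).
  apply: inc; last by exists c.
  + by split=> // s00; apply: s0; rewrite s00 muln0.
  + by split=> // t00; apply: t0; rewrite t00 muln0.
Qed.

(** Supplies the witness [S] for a given [M]; divisibility is what gives the inclusion of [M] in the
    dilate. *)
Lemma dilate_preimage (d : nat) (M : set nat) :
  common_divisor (Posz @` M) d -> dilate d [set s | M (d * s)%N] = M.
Proof.
move=> dM; apply/seteqP; split=> [_ [s Ms <-]//|m Mm].
have /dvdnP[s mE] : (d %| m)%N by apply: (dM m%:Z); exists m.
by exists s; rewrite /= mulnC -mE.
Qed.

Lemma common_divisor_dilate (d e : nat) (S : set nat) :
  common_divisor (Posz @` S) e -> common_divisor (Posz @` dilate d S) (d * e)%N.
Proof.
move=> eS _ [_ [s Ss <-] <-]; have es : (e %| s)%N by apply: (eS s%:Z); exists s.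
by rewrite dvdzE /= dvdn_mul.
Qed.

(** If [g] is the gcd of [S], then [d * g] divides all of [dilate d S], hence divides [d];
    cancelling [d] leaves [g] dividing 1. *)
Lemma numerical_of_gcd_dilate (d : nat) (S : set nat) :
  (0 < d)%N -> gcd_set (Posz @` dilate d S) = d -> numerical S.
Proof.
move=> d0 gcdE; have [gS _] := gcd_setP (Posz @` S).
have [_ /(_ _ (common_divisor_dilate d _ S gS))] :=
  gcd_setP (Posz @` dilate d S).
by rewrite gcdE -[X in (_ %| X)%N]muln1 dvdn_pmul2l// dvdn1 => /eqP.
Qed.

Lemma numerical_neq0 (S : set nat) : numerical S -> S <> [set 0%N].
Proof.
move=> numS SE; have [_ maxS] := gcd_setP (Posz @` S).
(* Since 0 divides 0, it is a common divisor of [[set 0]], yet it does not divide 1. *)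
suff /maxS : common_divisor (Posz @` S) 0 by rewrite numS.
by rewrite SE => _ [_ -> <-]; rewrite dvdz0.
Qed.

Lemma incentive_nonzero (C : set int) (M : set nat) :
  incentive C M -> M <> [set 0%N] -> exists2 m, M m & m <> 0%N.
Proof.
move=> [[M0 _] _] MN; apply: contrapT => noM; apply: MN.
apply/seteqP; split=> [m Mm|_ ->//]; apply: contrapT => mN0.
by apply: noM; exists m.
Qed.

Lemma common_divisor_incentive (C : set int) (M : set nat) (d : nat) :
  incentive C M -> M <> [set 0%N] -> common_divisor (Posz @` M) d ->
  common_divisor C d.
Proof.
move=> incM MN0 dM c Cc; have [m Mm m0] := incentive_nonzero C M incM MN0.
have dm : (d%:Z %| m%:Z)%Z by apply: dM; exists m.
have /dM : (Posz @` M) (m%:Z + m%:Z + c)%R by case: incM => _; apply.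
by rewrite rpredDl ?rpredD.
Qed.

Theorem theorem4p5 (C : set int) (C_neq0 : C !=set0) (C_fin : finite_set C) :
  incentives C `\` [set [set 0%N]] =
  \bigcup_(d in positive_divisors (gcd_set C))
    [set dilate d S | S in numerical_incentives (quotient_set C d)].
Proof.
have [gC maxC] := gcd_setP C.
apply/seteqP; split=> [M [/= incM MN0]|_ [d [d0 dg] [S [incS numS] <-]]].
- set d := gcd_set (Posz @` M); have [dM _] := gcd_setP (Posz @` M).
  have dC : common_divisor C d by exact: common_divisor_incentive dM.
  (* A gcd could be 0 only if [M] had no nonzero element. *)
  have d0 : (0 < d)%N.
    have [m Mm /eqP] := incentive_nonzero C M incM MN0.
    rewrite -lt0n => /dvdn_gt0; apply.
    by apply: (dM m%:Z); exists m.
  have ME := dilate_preimage d M dM.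
  exists d; first by split=> //; exact: maxC.
  exists [set s | M (d * s)%N] => //; split.
  + by apply/(incentive_dilate C d _ d0 dC); rewrite ME.
  + by apply: (numerical_of_gcd_dilate d) => //; rewrite ME.
- have dC : common_divisor C d.
    by move=> c /gC; apply: dvdz_trans; rewrite dvdzE.
  split=> /=; first exact/(incentive_dilate C d S d0 dC).
  (* As [d] is positive, a dilate equal to [[set 0]] forces [S] itself to be [[set 0]], which is not
     numerical. *)
  move=> dS0; apply: (numerical_neq0 S numS); apply/seteqP.
  split=> s; rewrite -(mem_dilate d S s d0) dS0 /=; last by move->; rewrite muln0.
  by move/eqP; rewrite muln_eq0 gtn_eqF//= => /eqP.
Qed.
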